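(* For every finite Coxeter group $W$, the biHecke monoid $M(W)$ is aperiodic: for every $f\in M(W)$ there exists $k>0$ such that $f^{k+1}=f^k$.
   Context: $W=\langle s_i\mid i\in I\rangle$ is a finite Coxeter group with length function $\ell$; $D_R(w)=\{i\in I:\ell(ws_i)<\ell(w)\}$ is the right descent set. The biHecke monoid $M(W)$ is the monoid of functions $W\to W$ (acting on the right) generated by all $\pi_i,\overline\pi_i$, $i\in I$, where $w.\pi_i=w$ if $i\in D_R(w)$ and $w.\pi_i=ws_i$ otherwise, and $w.\overline\pi_i=ws_i$ if $i\in D_R(w)$ and $w.\overline\pi_i=w$ otherwise. *)

(* Defs.v *)
From HB Require Import structures.
From mathcomp Require Import all_boot all_fingroup.

Set Implicit Arguments.
Unset Strict Implicit.
Unset Printing Implicit Defensive.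

Local Open Scope group_scope.

(* [W] is presented by the involutive generators [s i] and the braid relations
   [(s i * s j) ^+ m i j = 1]. The value [m i j = 0] encodes m(i, j) = infinity,
   for which the relation is void. *)
Record coxeter_system (I : finType) (W : finGroupType)
    (m : I -> I -> nat) (s : I -> W) : Prop := CoxeterSystem {
  cox_sym : forall i j, m i j = m j i;
  cox_diag : forall i j, m i j = 1%N <-> i = j;
  cox_rel : forall i j, (s i * s j) ^+ m i j = 1;
  cox_gen : << [set s i | i : I] >> = [set: W];
  cox_univ : forall (H : groupType) (t : I -> H),
    (forall i j, (t i * t j) ^+ m i j = 1) ->
    exists phi : W -> H,
      {morph phi : x y / x * y} /\ (forall i, phi (s i) = t i)
}.

Section Coxeter.

Variables (I : finType) (W : finGroupType) (m : I -> I -> nat) (s : I -> W).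
Hypothesis cox : coxeter_system m s.

Definition has_word (w : W) (n : nat) : bool :=
  [exists u : n.-tuple I, \prod_(i <- u) s i == w].

Lemma has_word_ex (w : W) : exists n, has_word w n.
Proof.
have : w \in << [set s i | i : I] >> by rewrite (cox_gen cox) inE.
case/gen_prodgP=> n [c cs ->].
have cs' k : exists i, s i == c k.
  by case/imsetP: (cs k) => i _ ->; exists i.
exists n; apply/existsP; exists [tuple xchoose (cs' k) | k < n].
rewrite big_tuple; apply/eqP/eq_bigr => k _.
by rewrite tnth_mktuple (eqP (xchooseP (cs' k))).
Qed.

Definition cox_length (w : W) : nat := ex_minn (has_word_ex w).

Definition right_descents (w : W) : {set I} :=
  [set i | cox_length (w * s i) < cox_length w].

End Coxeter.

(* A type alias: {ffun T -> T} itself already carries the pointwise product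
   when [T] is a group. *)
Definition transf (T : finType) : Type := {ffun T -> T}.

HB.instance Definition _ (T : finType) := Finite.copy (transf T) {ffun T -> T}.

Section TransfMonoid.

Variable T : finType.
Implicit Types f g h : transf T.

(* Transformations act on the right: [f * g] applies [f] first. *)
Definition transf_mul f g : transf T := [ffun x => g (f x)].
Definition transf_one : transf T := [ffun x => x].

Lemma transf_mulA : associative transf_mul.
Proof. by move=> f g h; apply/ffunP=> x; rewrite !ffunE. Qed.

Lemma transf_mul1x : left_id transf_one transf_mul.
Proof. by move=> f; apply/ffunP=> x; rewrite !ffunE. Qed.

Lemma transf_mulx1 : right_id transf_one transf_mul.
Proof. by move=> f; apply/ffunP=> x; rewrite !ffunE. Qed.

HB.instance Definition _ :=
  isMonoid.Build (transf T) transf_mulA transf_mul1x transf_mulx1.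

End TransfMonoid.

Inductive submonoid_gen (M : monoidType) (A : M -> Prop) : M -> Prop :=
  | submonoid_gen_one : submonoid_gen A 1
  | submonoid_gen_mem x of A x : submonoid_gen A x
  | submonoid_gen_mul x y of submonoid_gen A x & submonoid_gen A y :
      submonoid_gen A (x * y).

Definition aperiodic (M : monoidType) (A : M -> Prop) : Prop :=
  forall x, A x -> exists k : nat, (0 < k)%N /\ x ^+ k.+1 = x ^+ k.

Section BiHecke.

Variables (I : finType) (W : finGroupType) (m : I -> I -> nat) (s : I -> W).
Variable cox : coxeter_system m s.

Definition hecke_pi (i : I) : transf W :=
  [ffun w => if i \in right_descents cox w then w else w * s i].

Definition hecke_opi (i : I) : transf W :=
  [ffun w => if i \in right_descents cox w then w * s i else w].

Definition biHecke : transf W -> Prop :=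
  submonoid_gen (fun f => exists i, f = hecke_pi i \/ f = hecke_opi i).

End BiHecke.

(* Main.v *)
Require Import Defs.
From mathcomp Require Import all_boot all_fingroup.

(** Every element [f] of the biHecke monoid sends a left weak order cover
    [w < s_j w] either to a single element or to a cover with the same label
    [j]; by composition this need only be checked on generators, where it is the
    exchange condition.  Let [e] be an idempotent power of [f].  The images
    [e w] lie above [e 1] in left weak order, and [f] permutes them, so [f] fixes
    [e 1].  Climbing from [1] to [w] along covers, [f] then fixes every [e w]: if
    [f] fixes [x = e w] and [s_j x = e (s_j w)], then [f (s_j x)] is [x] or
    [s_j x], and the former is excluded because [f] is injective on the image of
    [e].  Hence [f ^+ k.+1 = f ^+ k] for [e = f ^+ k]. *)

Set Implicit Arguments.
Unset Strict Implicit.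
Unset Printing Implicit Defensive.

Local Open Scope group_scope.

(** * Signed conjugation and the reflection cocycle *)

Section ReflectionCocycle.

Variables (I : finType) (W : finGroupType) (m : I -> I -> nat) (s : I -> W).
Hypothesis cox : coxeter_system m s.

Lemma cox_invol i : s i * s i = 1.
Proof. by have := cox_rel cox i i; rewrite (iffRL (cox_diag cox i i)). Qed.

Lemma cox_mulK i : involutive (fun w => s i * w).
Proof. by move=> w; rewrite mulgA cox_invol mul1g. Qed.

Lemma cox_inv i : (s i)^-1 = s i.
Proof. by rewrite -[RHS]mulg1 -(mulgV (s i)) cox_mulK. Qed.

(* Along a word, the bit of [(x, b)] records the parity of the number of times
   the word crosses the wall of the reflection [x]; [x] is left to range over all
   of [W]. *)
Definition signed_conj i (p : W * bool) : W * bool :=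
  (p.1 ^ s i, p.2 (+) (p.1 == s i)).

Lemma signed_conjK i : involutive (signed_conj i).
Proof.
move=> [x b]; rewrite /signed_conj /= -conjgM cox_invol conjg1.
have -> : (x ^ s i == s i) = (x == s i).
  by rewrite (can2_eq (conjgK _) (conjgKV _)) conjgE invgK mulgV mulg1.
by rewrite -addbA addbb addbF.
Qed.

Definition signed_conj_perm i : {perm W * bool} :=
  perm (can_inj (signed_conjK i)).

Lemma signed_conj_permE i x b :
  signed_conj_perm i (x, b) = (x ^ s i, b (+) (x == s i)).
Proof. by rewrite permE. Qed.

(** Conjugation by [s i] inverts [s i * s j], as in a dihedral group. *)
Lemma cox_gen_conj_expV i j n :
  s i * (s i * s j) ^- n = (s i * s j) ^+ n * s i.
Proof.
rewrite conjgCV cox_inv conjVg conjXg -expVgn; congr (_ ^+ n * _).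
by rewrite conjgE cox_inv mulgA cox_mulK invMg !cox_inv.
Qed.

(** The alternating word with [n + n] letters crosses in turn the walls of [(s i * s j) ^+ k * s i],
    a word with [k.*2.+1] letters. *)
Lemma signed_conj_perm_exp i j n x b :
  ((signed_conj_perm i * signed_conj_perm j) ^+ n) (x, b) =
  (x ^ ((s i * s j) ^+ n),
   b (+) odd (\sum_(0 <= k < n + n) (x == (s i * s j) ^+ k * s i)%g)).
Proof.
elim: n x b => [|n IHn] x b.
  by rewrite big_geq //= perm1 conjg1 addbF.
rewrite expgSr permM IHn permM !signed_conj_permE addnS addSn.
rewrite 2?big_nat_recr //= !oddD !oddb -!conjgM -expgSr.
rewrite -!addbA; congr (_, _ (+) (_ (+) (_ (+) _))).
  rewrite (can2_eq (conjgK _) (conjgKV _)) conjgE invgK cox_gen_conj_expV.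
  by rewrite mulgA -expgnDr.
rewrite (can2_eq (conjgK _) (conjgKV _)) invMg conjgM cox_inv.
have -> : s j ^ s i = (s i * s j) * s i by rewrite conjgE cox_inv mulgA.
rewrite conjgE invgK -(mulgA (s i * s j)) cox_gen_conj_expV.
by rewrite mulgA -expgSr mulgA -expgnDr addSn.
Qed.

(* In [(s i * s j) ^+ m i j] each reflection is crossed twice, since
   [(s i * s j) ^+ k * s i] has period [m i j] in [k]. *)
Lemma signed_conj_perm_braid i j :
  (signed_conj_perm i * signed_conj_perm j) ^+ m i j = 1.
Proof.
apply/permP=> -[x b]; rewrite signed_conj_perm_exp perm1 (cox_rel cox) conjg1.
congr (_, _); rewrite (@big_cat_nat _ _ _ (m i j)) ?leq_addr //=.
rewrite -{2}[m i j]add0n big_addn addnK oddD.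
under [X in _ (+) (_ (+) odd X)]eq_bigr => k _ do
  rewrite expgnDr (cox_rel cox) mulg1.
by rewrite addbb addbF.
Qed.

Lemma cox_word w : exists2 u : seq I,
  \prod_(i <- u) s i = w & size u = cox_length cox w.
Proof.
rewrite /cox_length; case: ex_minnP => n /existsP[u /eqP uw] _.
by exists u; rewrite // size_tuple.
Qed.

(** By the universal property, signed conjugation extends to a morphism [phi] on [W]; [eta w] is its
    bit component, and multiplicativity of [phi] becomes the cocycle identity. *)
Lemma reflection_cocycle : exists eta : W -> W -> bool,
  (forall v w x, eta (v * w) x = eta v x (+) eta w (x ^ v)) /\
  (forall i x, eta (s i) x = (x == s i)).
Proof.
have [phi [phiM phis]] := cox_univ cox signed_conj_perm_braid.
pose eta w x := (phi w (x, false)).2.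
have phi1 : phi 1 = 1 by apply: (mulgI (phi 1)); rewrite -phiM !mulg1.
have phiE w x b : phi w (x, b) = (x ^ w, b (+) eta w x).
  have [u <- _] := cox_word w; elim: u x b => [|i u IHu] x b.
    by rewrite /eta big_nil phi1 !perm1 conjg1 addbF.
  rewrite /eta big_cons phiM !permM phis !signed_conj_permE.
  by rewrite !IHu /= conjgM addbA.
exists eta; split=> [v w x | i x]; last by rewrite /eta phis signed_conj_permE.
by rewrite {1}/eta phiM permM !phiE.
Qed.

(** * Length and the exchange condition *)

Lemma cox_length_prod (u : seq I) :
  cox_length cox (\prod_(i <- u) s i) <= size u.
Proof.
rewrite /cox_length; case: ex_minnP => n _; apply.
by apply/existsP; exists (in_tuple u).
Qed.

Lemma cox_length_mul i w : cox_length cox (s i * w) <= (cox_length cox w).+1.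
Proof.
have [u <- <-] := cox_word w.
by have := cox_length_prod (i :: u); rewrite big_cons.
Qed.

(* If a word crosses the wall of [x] an odd number of times, then left
   multiplication by [x] deletes one of its letters. *)
Lemma reflection_cocycle_descent : exists eta : W -> W -> bool,
  [/\ forall v w x, eta (v * w) x = eta v x (+) eta w (x ^ v),
      forall i x, eta (s i) x = (x == s i)
    & forall j w, eta w (s j) = (cox_length cox (s j * w) < cox_length cox w)].
Proof.
have [eta [etaM etas]] := reflection_cocycle; exists eta; split=> // j w.
have eta1 x : eta 1 x = false.
  by have := etaM 1 1 x; rewrite mulg1 conjg1; case: (eta 1 x).
have exch x u : eta (\prod_(i <- u) s i) x ->
    exists2 v, x * \prod_(i <- u) s i = \prod_(i <- v) s i & size v < size u.
  elim: u x => [|i u IHu] x; first by rewrite big_nil eta1.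
  rewrite big_cons etaM etas; have [-> _ | _ /= /IHu[v xpv ltvu]] := eqVneq.
    by exists u; rewrite // cox_mulK.
  by exists (i :: v); rewrite // big_cons -xpv conjgE cox_inv -!mulgA cox_mulK.
have lt_len v : eta v (s j) -> cox_length cox (s j * v) < cox_length cox v.
  have [u <- <-] := cox_word v => /exch[v' -> ].
  exact/leq_ltn_trans/cox_length_prod.
(* For the converse, [eta] at [s j] takes opposite values on [w] and [s j * w], so [lt_len] applies
   to the latter. *)
apply/idP/idP=> [/lt_len // | ]; apply: contraLR => eta'w.
rewrite -leqNgt ltnW // -{1}[w](cox_mulK j) lt_len // etaM etas eqxx.
by rewrite conjgE mulgA mulVg mul1g addTb eta'w.
Qed.

Lemma left_ascent_ind (P : W -> Prop) :
  P 1 ->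
  (forall j w, cox_length cox w < cox_length cox (s j * w) ->
     P w -> P (s j * w)) ->
  forall w, P w.
Proof.
move=> P1 PS w; have [n] := ubnP (cox_length cox w).
elim: n w => // n IHn w; have [[|i u] <-] := cox_word w; first by rewrite big_nil.
rewrite big_cons => sz_u; rewrite -sz_u ltnS => ltun.
(* The word [i :: u] is reduced, so dropping its first letter descends a cover. *)
have lt_u : cox_length cox (\prod_(k <- u) s k) < size (i :: u).
  exact: cox_length_prod.
by apply: PS; [rewrite -sz_u | apply: IHn; apply: leq_trans ltun].
Qed.

Lemma left_ascent_length j w : cox_length cox w < cox_length cox (s j * w) ->
  cox_length cox (s j * w) = (cox_length cox w).+1.
Proof. by move=> lt_w; apply/eqP; rewrite eqn_leq cox_length_mul. Qed.

(** The added letter [i] crosses the wall of [s j] only if [s j ^ w = s i]; otherwise [eta] at [s j]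
    keeps its value. *)
Lemma left_ascent_mulr i j w : cox_length cox w < cox_length cox (s j * w) ->
  s j * w = w * s i \/
  cox_length cox (w * s i) < cox_length cox (s j * (w * s i)).
Proof.
have [eta [etaM etas etaE]] := reflection_cocycle_descent => lt_w.
have [|neq] := eqVneq (s j ^ w) (s i); first by rewrite conjgC => ->; left.
right; have : eta (w * s i) (s j) = false.
  by rewrite etaM etas (negPf neq) etaE ltnNge ltnW.
have : eta (s j * (w * s i)) (s j) = ~~ eta (w * s i) (s j).
  by rewrite etaM etas eqxx conjgE mulgA mulVg mul1g addTb.
by rewrite !etaE cox_mulK => -> ->.
Qed.

(** * Maps contracting left weak order covers *)

Definition contracts_left_covers (f : W -> W) : Prop :=
  forall j w, cox_length cox w < cox_length cox (s j * w) ->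
    f (s j * w) = f w \/
    (f (s j * w) = s j * f w /\
     cox_length cox (f w) < cox_length cox (s j * f w)).

Lemma contracts_left_covers_comp (f g : W -> W) :
  contracts_left_covers f -> contracts_left_covers g ->
  contracts_left_covers (g \o f).
Proof.
move=> fP gP j w /fP /= [-> | [-> /gP //]]; by left.
Qed.

(** If [s j * w = w * s i], both ends of the cover go to the upper one. Otherwise [s j] raises the
    lengths of [w] and [w * s i] by one each, so [i] is a right descent of both ends or of
    neither. *)
Lemma hecke_pi_contracts i : contracts_left_covers (hecke_pi cox i).
Proof.
move=> j w lt_w; rewrite !ffunE !inE.
have [eq_sw | lt_ws] := left_ascent_mulr i lt_w.
  rewrite eq_sw in lt_w *; rewrite -mulgA cox_invol mulg1 lt_w.
  by rewrite ltnNge ltnW //; left.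
rewrite -mulgA (left_ascent_length lt_w) (left_ascent_length lt_ws) ltnS.
by right; case: ifP.
Qed.

Lemma hecke_opi_contracts i : contracts_left_covers (hecke_opi cox i).
Proof.
move=> j w lt_w; rewrite !ffunE !inE.
have [eq_sw | lt_ws] := left_ascent_mulr i lt_w.
  rewrite eq_sw in lt_w *; rewrite -mulgA cox_invol mulg1 lt_w.
  by rewrite ltnNge ltnW //; left.
rewrite -mulgA (left_ascent_length lt_w) (left_ascent_length lt_ws) ltnS.
by right; case: ifP.
Qed.

Lemma biHecke_contracts f : biHecke cox f -> contracts_left_covers f.
Proof.
elim=> [j w | g [i [|] ->] | g h _ IHg _ IHh].
- by rewrite !ffunE; right.
- exact: hecke_pi_contracts.
- exact: hecke_opi_contracts.
by move=> j w; rewrite !ffunE; apply: contracts_left_covers_comp.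
Qed.

(** Climbing from [1] to [w], the image either stays put or gets strictly longer, so [f 1] is the
    only shortest element of the image. *)
Lemma contracts_left_covers_min (f : W -> W) : contracts_left_covers f ->
  forall w, cox_length cox (f 1) <= cox_length cox (f w) ?= iff (f w == f 1).
Proof.
move=> fP; elim/left_ascent_ind => [|j w /fP[-> // | [-> lt_fw] IHw]].
  by rewrite eqxx; apply/leqif_refl.
have lt1 := leq_ltn_trans IHw lt_fw.
split; first exact: ltnW.
rewrite (ltn_eqF lt1); apply/esym/eqP=> eq1.
by rewrite eq1 ltnn in lt1.
Qed.

End ReflectionCocycle.

(** * Idempotent powers and aperiodicity *)

Lemma transf_expgE (T : finType) (f : transf T) n x : (f ^+ n) x = iter n f x.
Proof. by elim: n x => [|n IHn] x; rewrite ?expgSr ffunE //= IHn. Qed.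

Lemma transf_idempotent_power (T : finType) (f : transf T) :
  exists2 n, 0 < n & f ^+ n * f ^+ n = f ^+ n.
Proof.
have powE n : f ^+ n = iter n (fun g : transf T => g * f) 1.
  by elim: n => //= n <-; rewrite expgSr.
have /trajectP[a] := looping_order (fun g : transf T => g * f) 1.
set b := fingraph.order _ _; rewrite -!powE => lt_ab fab.
(* From exponent [a] on, the powers of [f] have period [b - a]. *)
have per n q : a <= n -> f ^+ (n + q * (b - a)) = f ^+ n.
  move=> le_an; elim: q => [|q IHq]; first by rewrite mul0n addn0.
  have -> : n + q.+1 * (b - a) = (n - a + q * (b - a)) + b.
    rewrite mulSn addnCA addnA -{1}(subnK le_an) addnCA subnK ?(ltnW lt_ab) //.
    by rewrite addnAC.
  by rewrite expgnDr fab -expgnDr addnAC subnK.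
(* A multiple of the period that is at least [a]; the factor [a.+1] keeps it positive when
   [a = 0]. *)
exists (a.+1 * (b - a))%N; first by rewrite muln_gt0 subn_gt0.
by rewrite -expgnDr per // (leq_trans (leqnSn a)) // leq_pmulr // subn_gt0.
Qed.

Theorem proposition4p13 (I : finType) (W : finGroupType)
    (m : I -> I -> nat) (s : I -> W) (cox : coxeter_system m s) :
  aperiodic (biHecke cox).
Proof.
move=> f /biHecke_contracts fP.
have [N N_gt0 eN] := transf_idempotent_power f.
exists N; split=> //; set e := f ^+ N in eN *.
have ef x : e (f x) = f (e x) by rewrite !transf_expgE -iterSr.
have ee x : e (e x) = e x by rewrite -[in RHS]eN ffunE.
have eP : contracts_left_covers cox e.
  rewrite /e; elim: N {N_gt0 e eN ef ee} => [|n IHn] j w.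
    by rewrite !ffunE; right.
  by rewrite expgSr !ffunE; apply: contracts_left_covers_comp.
(* As [N > 0], the value of [e] at a point depends only on that of [f]. *)
have f_inj x y : e x = x -> e y = y -> f x = f y -> x = y.
  move=> ex ey eq_f; rewrite -[LHS]ex -[RHS]ey !transf_expgE.
  by rewrite -(prednK N_gt0) !iterSr eq_f.
have fe1 : f (e 1) = e 1.
  have efP := contracts_left_covers_comp eP fP.
  (* This [x] is the preimage of [e 1] under [f] in the image of [e]. Minimality for [f \o e] at [x]
     and for [e] at [f (e 1)] gives [f (e 1)] and [e 1] equal length. *)
  pose x := iter N.-1 f (e 1).
  have fx : f x = e 1 by rewrite -iterS prednK // -transf_expgE ee.
  have ex : e x = x.
    by rewrite /x; elim: N.-1 => [|n IHn] /=; rewrite ?ee // ef IHn.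
  have := contracts_left_covers_min efP x; rewrite /= ex fx => - [le1 _].
  have := contracts_left_covers_min eP (f (e 1)); rewrite ef ee => - [le2 eq2].
  by apply/eqP; rewrite -eq2 eqn_leq le2.
have fe w : f (e w) = e w.
  elim/(left_ascent_ind (cox := cox)): w => // j w /eP[-> // | [esw lt_ew] fw].
  have [fsw | [fsw _]] := fP _ _ lt_ew; last by rewrite esw fsw fw.
  suff eq_sew : s j * e w = e w by rewrite eq_sew ltnn in lt_ew.
  by apply: f_inj; rewrite // -esw ee.
by apply/ffunP=> w; rewrite expgSr ffunE fe.
Qed.
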